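(* Let $(f_n)_n$ be a sequence of integrable functions $f_n:G\to\mathbf X_1$ which converges in $\mu$-measure to $0$ on every set $A\in\mathcal A$ with $\mu(A)\in\mathbf X_2$, and whose integrals are $\mu$-equiabsolutely continuous. Then $(f_n)_n$ converges in $L^1$ to $0$, that is, $\ell\big(\big(\int_G|f_n(g)|\,d\mu(g)\big)_n\big)=0$.
   Context: Conventions. All vector lattices are Dedekind complete. For such a lattice $Y$: $Y^+=\{y\in Y:y\ge 0\}$, $|y|=y\vee(-y)$, $\overline Y^+=Y^+\cup\{+\infty\}$ with order and operations extended in the natural way and $0\cdot(+\infty)=0$. An $(o)$-sequence in $Y$ is a decreasing sequence in $Y^+$ with infimum $0$. ''Definitely'' means for all but finitely many $n$. The supremum of an empty family of positive elements is $0$. Convergences. A convergence on $Y$ is a pair $(\mathcal S,\ell)$, where $\mathcal S$ is a linear subspace of the space of all sequences in $Y$ and $\ell:\mathcal S\to Y$ satisfies: (a) $\ell$ is linear; (b) if $(x_n),(y_n)\in\mathcal S$ and $x_n\le y_n$ definitely, then $\ell((x_n))\le\ell((y_n))$; (c) if $x_n=c$ definitely then $(x_n)\in\mathcal S$ and $\ell((x_n))=c$; if $(x_n)\in\mathcal S$ and $x_n\ne y_n$ for only finitely many $n$, then $(y_n)\in\mathcal S$ and $\ell((y_n))=\ell((x_n))$; (d) if $(x_n)\in\mathcal S$ then $(|x_n|)\in\mathcal S$ and $\ell((|x_n|))=|\ell((x_n))|$; (e) if $(x_n),(z_n)\in\mathcal S$, $\ell((x_n))=\ell((z_n))$ and $x_n\le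 y_n\le z_n$ definitely, then $(y_n)\in\mathcal S$; (f) for $u\in Y^+$, $(\frac1n u)_n\in\mathcal S$ and $\ell((\frac1n u)_n)=0$. Writing $\ell((x_n)_n)=c$ means that $(x_n)_n$ is a sequence in $Y$ belonging to $\mathcal S$ and that the value of $\ell$ is $c$. Limit superior. Each convergence $(\mathcal S,\ell)$ comes with a map $\overline\ell$ from the set of sequences in $Y^+$ to $\overline Y^+$ such that: (a) $\overline\ell((x_n))=\overline\ell((y_n))$ if $x_n=y_n$ definitely; (b) $\overline\ell((x_n+y_n))\le\overline\ell((x_n))+\overline\ell((y_n))$; (c) if $x_n\le y_n$ definitely then $\overline\ell((x_n))\le\overline\ell((y_n))$; (d) $\overline\ell((x_n))=\ell((x_n))$ if $(x_n)\in\mathcal S$; (e) if $\overline\ell((x_n))=0$ then $(x_n)\in\mathcal S$ and $\ell((x_n))=0$. Product triples. $(Y_1,Y_2,Y)$, with convergences $\ell_1,\ell_2,\ell$ (and $\overline\ell_1,\overline\ell_2,\overline\ell$), is a product triple if there is a map $\cdot:Y_1\times Y_2\to Y$ with: (1),(2) additivity in each variable; (3) $x_1\ge y_1$ and $x_2\ge0$ imply $x_1\cdot x_2\ge y_1\cdot x_2$; (4) $x_1\ge0$ and $x_2\ge y_2$ imply $x_1\cdot x_2\ge x_1\cdot y_2$; (5) if $(x_n)$ is an $(o)$-sequence in $Y_1$ and $y\in Y_2^+$, then $(x_n\cdot y)$ is an $(o)$-sequence; (6) if $x\in Y_1^+$ and $(y_n)$ is an $(o)$-sequence in $Y_2$,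 then $(x\cdot y_n)$ is an $(o)$-sequence; (7) $\ell_1((x_n))=0$, $y\in Y_2$ imply $\ell((x_n\cdot y))=0$; (8) $x\in Y_1$, $\ell_2((y_n))=0$ imply $\ell((x\cdot y_n))=0$; (9) $x_n\in Y_1^+$, $\overline\ell_1((x_n))=x$, $y\in Y_2^+$ imply $\overline\ell((x_n\cdot y))=x\cdot y$; (10) $x\in Y_1^+$, $y_n\in Y_2^+$, $\overline\ell_2((y_n))=y$ imply $\overline\ell((x\cdot y_n))=x\cdot y$. $Y$ is a product algebra if $(Y,Y,Y)$ is a product triple. Setting. $(\mathbf X_1,\mathbf X_2,\mathbf X)$ is a product triple with convergences $\ell_1,\ell_2,\ell$; $\mathbf X_1,\mathbf X_2,\mathbf X$ are product algebras; $\mathbb R$ carries a convergence $\ell_{\mathbb R}$, and $(\mathbb R,\mathbf X,\mathbf X)$, $(\mathbb R,\mathbf X_j,\mathbf X_j)$ ($j=1,2$) are product triples. $G$ is a nonempty set, $\mathcal A$ an algebra of subsets of $G$, $\mu:\mathcal A\to\overline{\mathbf X}_2^+$ a finitely additive measure that is $\sigma$-finite: $G=\bigcup_n B_n$ for some $B_n\in\mathcal A$ with $\mu(B_n)\in\mathbf X_2^+$. Simple functions. $f:G\to\mathbf X_1$ is simple if $f=\sum_{j=1}^r c_j\chi_{A_j}$ with $c_j\in\mathbf X_1$, $A_j\in\mathcal A$, $\mu(A_j)\in\mathbf X_2^+$; then $\int_A f\,d\mu=\sum_j c_j\cdot\mu(A\cap A_j)$ for $A\in\mathcal A$ (independent of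 the representation). Convergence in measure. $(f_n)_n$ converges in $\mu$-measure to $f$ on $A\in\mathcal A$ if there is a sequence $(A_n)_n$ in $\mathcal A$ with $\ell_2((\mu(A\cap A_n))_n)=0$ and $\ell_1\big(\big(\bigvee_{g\in A\setminus A_n}|f_n(g)-f(g)|\big)_n\big)=0$. Equiabsolute continuity. The integrals of a sequence $(f_n)_n$ of simple functions (or, with the same definition, of integrable functions, see below) are $\mu$-equiabsolutely continuous if: (i) $\ell\big(\big(\int_{A_n}|f_n|\,d\mu\big)_n\big)=0$ for every sequence $(A_n)_n$ in $\mathcal A$ with $\ell_2((\mu(A_n))_n)=0$; (ii) there is an increasing sequence $(B_m)_m$ in $\mathcal A$ with $\mu(B_m)\in\mathbf X_2$ for all $m$ and $\ell\Big(\Big(\overline\ell\Big(\Big(\int_{G\setminus B_m}|f_n|\,d\mu\Big)_n\Big)\Big)_m\Big)=0$. Integral. A sequence $(f_n)_n$ of simple functions is defining for $f:G\to\mathbf X_1$ if it converges in $\mu$-measure to $f$ on every $A\in\mathcal A$ with $\mu(A)\in\mathbf X_2$ and its integrals are $\mu$-equiabsolutely continuous. A positive $f:G\to\mathbf X_1$ is integrable if there are a defining sequence $(f_n)_n$ for $f$ and a map $l:\mathcal A\to\mathbf X$ with $\ell\big(\big(\bigvee_{A\in\mathcal A}|\int_A f_n\,d\mu-l(A)|\big)_n\big)=0$; then $\int_A f\,d\mu:=l(A)$ (this is independent of choices). A general $f:G\to\mathbf X_1$ is integrable if $f^+=f\vee0$ and $f^-=(-f)\vee0$ are, and $\int_A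 f\,d\mu=\int_A f^+\,d\mu-\int_A f^-\,d\mu$; then $|f|$ is integrable too. *)

(* Defs.v *)
From HB Require Import structures.
From mathcomp Require Import all_boot all_order all_algebra.
From mathcomp Require Import all_classical all_reals all_analysis.

Set Implicit Arguments.
Unset Strict Implicit.
Unset Printing Implicit Defensive.

Import Order.TTheory GRing.Theory Num.Theory.
Import numFieldNormedType.Exports.

Local Open Scope classical_set_scope.
Local Open Scope ring_scope.

(** * Dedekind complete vector lattices *)

(* [Order.Lattice] cannot be joined with [GRing.Lmodule] here, as
   [Num.RealDomain] already inherits from lattices and additive groups without
   a common intermediate structure; the binary join is thus given explicitly.
   The meet of [x] and [y] is [- vjoin (- x) (- y)]. *)
HB.mixin Record isVectorLattice (R : realType) V
    & GRing.Lmodule R V & Num.POrderedZmodule V := {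
  vjoin : V -> V -> V;
  vlat_leD2r : forall x y z : V, x <= y -> x + z <= y + z;
  vlat_scale_ge0 : forall (a : R) (x : V), 0 <= a -> 0 <= x -> 0 <= a *: x;
  vjoin_lub : forall x y : V, isLub [set x; y] (vjoin x y)
}.

#[short(type="vectorLatticeType")]
HB.structure Definition VectorLattice (R : realType) :=
  {V of GRing.Lmodule R V & Num.POrderedZmodule V & isVectorLattice R V}.

HB.mixin Record isDedekindComplete (R : realType) V & VectorLattice R V := {
  dedekind_complete : forall E : set V, has_sup E -> exists s, isLub E s
}.

#[short(type="dcVectorLatticeType")]
HB.structure Definition DCVectorLattice (R : realType) :=
  {V of VectorLattice R V & isDedekindComplete R V}.

Section real_line.
Variable R : realType.

HB.instance Definition _ := Num.POrderedZmodule.on R^o.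

Let leD2r (x y z : R^o) : x <= y -> x + z <= y + z.
Proof. by move=> xy; rewrite (@lerD2r R). Qed.

Let scale_ge0 (a : R) (x : R^o) : 0 <= a -> 0 <= x -> 0 <= a *: x.
Proof. exact: (@mulr_ge0 R). Qed.

Let max_lub (x y : R^o) : isLub [set x; y] (Num.max (x : R) y : R^o).
Proof.
split=> [z [->|->]|b bub]; first by rewrite (@le_max _ R) lexx.
  by rewrite (@le_max _ R) lexx orbT.
by rewrite (@ge_max _ R); apply/andP; split; apply: bub; [left|right].
Qed.

HB.instance Definition _ :=
  isVectorLattice.Build R R^o leD2r scale_ge0 max_lub.

Let complete (E : set R^o) : has_sup E -> exists s, isLub E s.
Proof.
move=> E_sup; exists (sup (E : set R)); split => [x Ex|b].
  exact: (@ub_le_sup R E E_sup.2 x Ex).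
by move=> Eb; apply: (@ge_sup R E b E_sup.1) => x; exact: Eb.
Qed.

HB.instance Definition _ := isDedekindComplete.Build R R^o complete.

End real_line.

Section lattice_operations.
Context {R : realType} {V : vectorLatticeType R}.

Definition vabs (x : V) : V := vjoin x (- x).
Definition vpos (x : V) : V := vjoin x 0.
Definition vneg (x : V) : V := vjoin (- x) 0.

(* Supremum of a family of positive elements: that of the empty family is 0. *)
Definition pos_sup (E : set V) (s : V) : Prop :=
  (E !=set0 -> isLub E s) /\ (E = set0 -> s = 0).

Definition o_sequence (x : nat -> V) : Prop :=
  [/\ nonincreasing_seq x, forall n, 0 <= x n & infimums (range x) 0].

End lattice_operations.

(** * The positive cone with [+oo] adjoined *)

(* The library type [\bar V] is not usable here: it also contains [-oo], and
   its order and operations require a [numDomainType].  Membership in the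
   cone is the predicate [xnneg]. *)
Inductive xcone (V : Type) := XFin of V | XInf.
Arguments XFin {V}.
Arguments XInf {V}.

Section extended_cone.
Context {R : realType} {V : vectorLatticeType R}.

Definition xnneg (x : xcone V) : Prop := if x is XFin v then 0 <= v else True.

Definition xfinite (x : xcone V) : Prop := exists v, x = XFin v.

Definition xval (x : xcone V) : V := if x is XFin v then v else 0.

Definition xle (x y : xcone V) : Prop :=
  match x, y with
  | _, XInf => True
  | XFin u, XFin v => u <= v
  | XInf, XFin _ => False
  end.

Definition xadd (x y : xcone V) : xcone V :=
  if x is XFin u then if y is XFin v then XFin (u + v) else XInf else XInf.

End extended_cone.

Definition xmul (R : realType) (V1 V2 V : vectorLatticeType R)
    (m : V1 -> V2 -> V) (x : xcone V1) (y : xcone V2) : xcone V :=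
  match x, y with
  | XFin u, XFin v => XFin (m u v)
  | XFin u, XInf => if u == 0 then XFin 0 else XInf
  | XInf, XFin v => if v == 0 then XFin 0 else XInf
  | XInf, XInf => XInf
  end.

(** * Convergences *)

(* [conv_lim] is only meaningful on [conv_dom], [conv_limsup] only on
   sequences of positive elements. *)
Record convergence (R : realType) (V : dcVectorLatticeType R) := Convergence {
  conv_dom : set (nat -> V);
  conv_lim : (nat -> V) -> V;
  conv_limsup : (nat -> V) -> xcone V;
  conv_domD : forall x y, conv_dom x -> conv_dom y ->
    conv_dom (fun n => x n + y n);
  conv_domZ : forall (a : R) x, conv_dom x -> conv_dom (fun n => a *: x n);
  conv_limD : forall x y, conv_dom x -> conv_dom y ->
    conv_lim (fun n => x n + y n) = conv_lim x + conv_lim y;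
  conv_limZ : forall (a : R) x, conv_dom x ->
    conv_lim (fun n => a *: x n) = a *: conv_lim x;
  conv_lim_le : forall x y, conv_dom x -> conv_dom y ->
    (\forall n \near \oo, x n <= y n) -> conv_lim x <= conv_lim y;
  conv_cst : forall x (v : V), (\forall n \near \oo, x n = v) ->
    conv_dom x /\ conv_lim x = v;
  conv_near : forall x y, conv_dom x -> (\forall n \near \oo, x n = y n) ->
    conv_dom y /\ conv_lim y = conv_lim x;
  conv_abs : forall x, conv_dom x ->
    conv_dom (fun n => vabs (x n)) /\
    conv_lim (fun n => vabs (x n)) = vabs (conv_lim x);
  conv_squeeze : forall x y z, conv_dom x -> conv_dom z ->
    conv_lim x = conv_lim z ->
    (\forall n \near \oo, x n <= y n /\ y n <= z n) -> conv_dom y;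
  conv_harmonic : forall u : V, 0 <= u ->
    conv_dom (fun n => (n.+1%:R : R)^-1 *: u) /\
    conv_lim (fun n => (n.+1%:R : R)^-1 *: u) = 0;
  conv_limsup_ge0 : forall x, (forall n, 0 <= x n) -> xnneg (conv_limsup x);
  conv_limsup_near : forall x y,
    (forall n, 0 <= x n) -> (forall n, 0 <= y n) ->
    (\forall n \near \oo, x n = y n) -> conv_limsup x = conv_limsup y;
  conv_limsupD : forall x y,
    (forall n, 0 <= x n) -> (forall n, 0 <= y n) ->
    xle (conv_limsup (fun n => x n + y n))
        (xadd (conv_limsup x) (conv_limsup y));
  conv_limsup_le : forall x y,
    (forall n, 0 <= x n) -> (forall n, 0 <= y n) ->
    (\forall n \near \oo, x n <= y n) ->
    xle (conv_limsup x) (conv_limsup y);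
  conv_limsupE : forall x, (forall n, 0 <= x n) -> conv_dom x ->
    conv_limsup x = XFin (conv_lim x);
  conv_limsup_eq0 : forall x, (forall n, 0 <= x n) ->
    conv_limsup x = XFin 0 -> conv_dom x /\ conv_lim x = 0
}.

Section converges.
Context {R : realType} {V : dcVectorLatticeType R} (c : convergence V).

Definition conv_to (x : nat -> V) (v : V) : Prop :=
  conv_dom c x /\ conv_lim c x = v.

(* All the terms are required to be finite. *)
Definition xconv_to (x : nat -> xcone V) (v : V) : Prop :=
  exists2 y : nat -> V, forall n, x n = XFin (y n) & conv_to y v.

(* The suprema are required to exist in [V]. *)
Definition sup_conv_to (E : nat -> set V) (v : V) : Prop :=
  exists2 s : nat -> V, forall n, pos_sup (E n) (s n) & conv_to s v.

End converges.

(** * Product triples *)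

Record product_triple (R : realType) (V1 V2 V : dcVectorLatticeType R)
    (c1 : convergence V1) (c2 : convergence V2) (c : convergence V) :=
  ProductTriple {
  triple_mul :> V1 -> V2 -> V;
  triple_mulDl : forall x1 y1 x2,
    triple_mul (x1 + y1) x2 = triple_mul x1 x2 + triple_mul y1 x2;
  triple_mulDr : forall x1 x2 y2,
    triple_mul x1 (x2 + y2) = triple_mul x1 x2 + triple_mul x1 y2;
  triple_le_mull : forall x1 y1 x2, y1 <= x1 -> 0 <= x2 ->
    triple_mul y1 x2 <= triple_mul x1 x2;
  triple_le_mulr : forall x1 x2 y2, 0 <= x1 -> y2 <= x2 ->
    triple_mul x1 y2 <= triple_mul x1 x2;
  triple_o_seql : forall x y, o_sequence x -> 0 <= y ->
    o_sequence (fun n => triple_mul (x n) y);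
  triple_o_seqr : forall x y, 0 <= x -> o_sequence y ->
    o_sequence (fun n => triple_mul x (y n));
  triple_convl : forall x y, conv_to c1 x 0 ->
    conv_to c (fun n => triple_mul (x n) y) 0;
  triple_convr : forall x y, conv_to c2 y 0 ->
    conv_to c (fun n => triple_mul x (y n)) 0;
  triple_limsupl : forall x y, (forall n, 0 <= x n) -> 0 <= y ->
    conv_limsup c (fun n => triple_mul (x n) y) =
    xmul triple_mul (conv_limsup c1 x) (XFin y);
  triple_limsupr : forall x y, 0 <= x -> (forall n, 0 <= y n) ->
    conv_limsup c (fun n => triple_mul x (y n)) =
    xmul triple_mul (XFin x) (conv_limsup c2 y)
}.

Definition product_algebra (R : realType) (V : dcVectorLatticeType R)
  (c : convergence V) := product_triple c c c.

(** * Finitely additive measures *)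

(* The type [G] is pointed, hence nonempty; [measurable] is its algebra. *)
Record fa_measure (R : realType) (V : dcVectorLatticeType R)
    (d : measure_display) (G : algebraOfSetsType d) := FaMeasure {
  fa_mu :> set G -> xcone V;
  fa_mu_ge0 : forall A, measurable A -> xnneg (fa_mu A);
  fa_mu0 : fa_mu set0 = XFin 0;
  fa_muU : forall A B, measurable A -> measurable B -> A `&` B = set0 ->
    fa_mu (A `|` B) = xadd (fa_mu A) (fa_mu B)
}.
Arguments fa_measure {R} V {d} G.

Definition fa_sigma_finite (R : realType) (V : dcVectorLatticeType R)
    (d : measure_display) (G : algebraOfSetsType d) (mu : fa_measure V G) :=
  exists B : nat -> set G,
    (forall n, measurable (B n) /\ xfinite (mu (B n))) /\
    \bigcup_n B n = [set: G].

(** * Integration *)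

Section integration.
Context {R : realType} {X1 X2 X : dcVectorLatticeType R}
  {c1 : convergence X1} {c2 : convergence X2} {c : convergence X}
  (p : product_triple c1 c2 c)
  {d : measure_display} {G : algebraOfSetsType d} (mu : fa_measure X2 G).

Implicit Types (f : G -> X1) (A : set G).

Definition simple_repr f (r : nat) (a : 'I_r -> X1) (A_ : 'I_r -> set G) :=
  (forall j, measurable (A_ j) /\ xfinite (mu (A_ j))) /\
  f = (fun g => \sum_(j < r) \1_(A_ j) g *: a j).

Definition simple_fun f := exists r (a : 'I_r -> X1) (A_ : 'I_r -> set G),
  simple_repr f a A_.

(* The value does not depend on the representation, so that any choice of
   one will do. *)
Definition simple_integral f A : X :=
  xget 0 [set v | exists r (a : 'I_r -> X1) (A_ : 'I_r -> set G),
                  simple_repr f a A_ /\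
                  v = \sum_(j < r) p (a j) (xval (mu (A `&` A_ j)))].

Definition cvg_in_measure (f_ : nat -> G -> X1) f A : Prop :=
  exists A_ : nat -> set G,
    [/\ forall n, measurable (A_ n),
        xconv_to c2 (fun n => mu (A `&` A_ n)) 0 &
        sup_conv_to c1
          (fun n => [set vabs (f_ n g - f g) | g in A `\` A_ n]) 0].

(* [I] is [simple_integral] for simple functions, and [lat_integral] below for
   integrable ones. *)
Definition equiabs_continuous (I : (G -> X1) -> set G -> X)
    (f_ : nat -> G -> X1) : Prop :=
  (forall A_ : nat -> set G, (forall n, measurable (A_ n)) ->
     xconv_to c2 (fun n => mu (A_ n)) 0 ->
     conv_to c (fun n => I (vabs \o f_ n) (A_ n)) 0) /\
  (exists B : nat -> set G,
     [/\ forall m, measurable (B m) /\ xfinite (mu (B m)),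
         forall m n, (m <= n)%N -> B m `<=` B n &
         xconv_to c (fun m =>
           conv_limsup c (fun n => I (vabs \o f_ n) (~` B m))) 0]).

Definition defining (f_ : nat -> G -> X1) f : Prop :=
  [/\ forall n, simple_fun (f_ n),
      forall A, measurable A -> xfinite (mu A) -> cvg_in_measure f_ f A &
      equiabs_continuous simple_integral f_].

Definition lat_pos_integral_spec f (l : set G -> X) : Prop :=
  exists2 f_ : nat -> G -> X1, defining f_ f &
    sup_conv_to c
      (fun n => [set vabs (simple_integral (f_ n) A - l A)
                | A in measurable]) 0.

Definition lat_pos_integrable f : Prop :=
  (forall g, 0 <= f g) /\ exists l, lat_pos_integral_spec f l.

(* On measurable sets, the value does not depend on the choice of [l]. *)
Definition lat_pos_integral f : set G -> X :=
  xget (fun=> 0) [set l | lat_pos_integral_spec f l].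

Definition lat_integrable f : Prop :=
  lat_pos_integrable (vpos \o f) /\ lat_pos_integrable (vneg \o f).

Definition lat_integral f A : X :=
  lat_pos_integral (vpos \o f) A - lat_pos_integral (vneg \o f) A.

End integration.

Arguments cvg_in_measure {R X1 X2} c1 c2 {d G} mu f_ f A.
Arguments equiabs_continuous {R X1 X2 X} c2 c {d G} mu I f_.

(* Main.v *)
(* Let [(B m)] be the sets of condition (ii) of equiabsolute continuity, fix
   [m], and let [(E n)] be the exceptional sets of the convergence in measure
   on [B m].  The integral of [|f_ n|] over [G] splits over [~` B m],
   [B m `&` E n] and [B m `\` E n]: the second term tends to 0 by condition
   (i), and the third one is at most the uniform bound of [|f_ n|] on
   [B m `\` E n] times [mu (B m)].  Hence the limit superior of the integrals
   over [G] is at most that over [~` B m], for every [m], and thus is 0.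
   Of the integral of a positive function, this uses only positivity,
   additivity with respect to the set, and the bound [u * mu A] for functions
   at most [u] on [A]; all three pass to the limit from simple functions. *)
Require Import Defs.
From mathcomp Require Import all_boot all_order all_algebra.
From mathcomp Require Import all_classical all_reals all_analysis.
Import Order.TTheory GRing.Theory Num.Theory.
Local Open Scope classical_set_scope.
Local Open Scope ring_scope.

(** * Order and absolute value in vector lattices *)

Section vector_lattice.
Set Implicit Arguments.
Unset Strict Implicit.
Context {R : realType} {V : vectorLatticeType R}.
Implicit Types x y z : V.

Lemma vle_add x y z w : x <= y -> z <= w -> x + z <= y + w :> V.
Proof.
move=> xy zw; apply: (le_trans (vlat_leD2r _ _ z xy)).
by rewrite ![y + _]addrC; exact: vlat_leD2r.
Qed.

Lemma vadd_ge0 x y : 0 <= x -> 0 <= y -> 0 <= x + y.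
Proof. by move=> x0 y0; have := vle_add x0 y0; rewrite addr0. Qed.

Lemma vsubr_ge0 x y : (0 <= y - x) = (x <= y).
Proof.
apply/idP/idP => [/(vlat_leD2r _ _ x)|/(vlat_leD2r _ _ (- x))].
  by rewrite add0r subrK.
by rewrite subrr.
Qed.

Lemma vlerN2 x y : (- x <= - y) = (y <= x).
Proof. by rewrite -(vsubr_ge0 (- x)) opprK addrC vsubr_ge0. Qed.

Lemma vler_subl x y z : (x - y <= z) = (x <= z + y).
Proof. by rewrite -(vsubr_ge0 (x - y)) opprB addrA vsubr_ge0. Qed.

Lemma voppr_le0 x : (- x <= 0) = (0 <= x).
Proof. by rewrite -[X in _ <= X]oppr0 vlerN2. Qed.

Lemma vjoin_le x y z : (vjoin x y <= z) <-> x <= z /\ y <= z.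
Proof.
have [ub lub] := vjoin_lub x y; split=> [le|[xz yz]].
  by split; apply: le_trans le; apply: ub; [left|right].
by apply: lub => _ [->|->].
Qed.

Lemma vjoin_ubl x y : x <= vjoin x y.
Proof. by apply: (vjoin_lub x y).1; left. Qed.

Lemma vjoin_ubr x y : y <= vjoin x y.
Proof. by apply: (vjoin_lub x y).1; right. Qed.

Lemma vabs_le x y : vabs x <= y <-> x <= y /\ - x <= y.
Proof. exact: vjoin_le. Qed.

Lemma le_vabs x : x <= vabs x.
Proof. exact: vjoin_ubl. Qed.

Lemma leN_vabs x : - x <= vabs x.
Proof. exact: vjoin_ubr. Qed.

(** Adding [x <= vabs x] and [- x <= vabs x] shows that twice the absolute value is nonnegative;
    scaling by one half concludes. *)
Lemma vabs_ge0 x : 0 <= vabs x.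
Proof.
have x2 : 0 <= 2%:R *: vabs x.
  rewrite scaler_nat mulr2n -(subrr x).
  exact: vle_add (le_vabs x) (leN_vabs x).
have half_ge0 : 0 <= 2%:R^-1 :> R by rewrite invr_ge0 ler0n.
have := vlat_scale_ge0 _ _ half_ge0 x2.
by rewrite scalerA mulVf ?scale1r// pnatr_eq0.
Qed.

Lemma vabsN x : vabs (- x) = vabs x.
Proof.
apply: le_anti; rewrite (vabs_le (- x) _).2; last first.
  by rewrite opprK; split; [exact: leN_vabs|exact: le_vabs].
rewrite (vabs_le x _).2//; split; last exact: le_vabs.
by rewrite -{1}[x]opprK leN_vabs.
Qed.

Lemma vjoin_l x y : y <= x -> vjoin x y = x.
Proof.
move=> yx; apply: le_anti.
by rewrite vjoin_ubl ((vjoin_le x y x).2 (conj (lexx x) yx)).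
Qed.

Lemma ger0_vabs x : 0 <= x -> vabs x = x.
Proof.
by move=> x0; apply: vjoin_l; apply: (le_trans _ x0); rewrite voppr_le0.
Qed.

Lemma vabs0 : vabs (0 : V) = 0. Proof. exact: ger0_vabs. Qed.

Lemma vpos_ge0 x : 0 <= x -> vpos x = x. Proof. exact: vjoin_l. Qed.

Lemma vneg_ge0 x : 0 <= x -> vneg x = 0.
Proof.
rewrite -voppr_le0 => x0; apply: le_anti.
by rewrite vjoin_ubr ((vjoin_le (- x) 0 0).2 (conj x0 (lexx 0))).
Qed.

Lemma pos_sup_ub (E : set V) s x : pos_sup E s -> E x -> x <= s.
Proof. by move=> [Es _] Ex; apply: (Es _).1 => //; exists x. Qed.

Lemma pos_sup_ge0 (E : set V) s :
  (forall x, E x -> 0 <= x) -> pos_sup E s -> 0 <= s.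
Proof.
move=> E0 Es; have [E_eq0|/set0P[x Ex]] := eqVneq E set0.
  by rewrite Es.2.
exact: le_trans (E0 _ Ex) (pos_sup_ub Es Ex).
Qed.

End vector_lattice.

(** * Algebra and order of limits *)

Section convergence_theory.
Set Implicit Arguments.
Unset Strict Implicit.
Context {R : realType} {V : dcVectorLatticeType R} (c : convergence V).
Implicit Types (x y : nat -> V) (a b : V).

Lemma conv_to_cst a : conv_to c (fun=> a) a.
Proof. by apply: (conv_cst c); exists 0%N. Qed.

Lemma conv_to_ext x y a : x =1 y -> conv_to c x a -> conv_to c y a.
Proof. by move=> /funext ->. Qed.

Lemma conv_toD x y a b : conv_to c x a -> conv_to c y b ->
  conv_to c (fun n => x n + y n) (a + b).
Proof.
by move=> [dx <-] [dy <-]; split; [exact: conv_domD|exact: conv_limD].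
Qed.

Lemma conv_toN x a : conv_to c x a -> conv_to c (fun n => - x n) (- a).
Proof.
move=> [dx <-]; apply: (@conv_to_ext (fun n => -1 *: x n)) => [n|].
  by rewrite scaleN1r.
by split; [exact: conv_domZ|rewrite conv_limZ// scaleN1r].
Qed.

Lemma conv_to_vabs x a : conv_to c x a ->
  conv_to c (fun n => vabs (x n)) (vabs a).
Proof. by move=> [dx <-]; exact: (conv_abs dx). Qed.

Lemma conv_to_le x y a b : conv_to c x a -> conv_to c y b ->
  (forall n, x n <= y n) -> a <= b.
Proof.
by move=> [dx <-] [dy <-] xy; apply: conv_lim_le => //; exists 0%N => // n _.
Qed.

Lemma conv_to_unique x a b : conv_to c x a -> conv_to c x b -> a = b.
Proof. by move=> [_ <-] [_ <-]. Qed.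

(** The squeeze axiom only puts [y] in the domain; monotonicity of the limit then determines its
    value. *)
Lemma conv_to_squeeze x y z a : conv_to c x a -> conv_to c z a ->
  (forall n, x n <= y n) -> (forall n, y n <= z n) -> conv_to c y a.
Proof.
move=> cx cz xy yz; have [[dx xa] [dz za]] := (cx, cz).
have dy : conv_dom c y.
  by apply: (conv_squeeze dx dz); [rewrite xa za|exists 0%N].
split=> //; apply: le_anti.
by rewrite (conv_to_le (conj dy erefl) cz yz)
           (conv_to_le cx (conj dy erefl) xy).
Qed.

(** The difference [x n - a] is squeezed between [- y n] and [y n]. *)
Lemma conv_to_dist0 x y a : conv_to c y 0 ->
  (forall n, vabs (x n - a) <= y n) -> conv_to c x a.
Proof.
move=> cy xay; rewrite -[a]add0r.
apply: (@conv_to_ext (fun n => (x n - a) + a)) => [n|]; first by rewrite subrK.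
apply: conv_toD (conv_to_cst a); have := conv_toN cy; rewrite oppr0 => cNy.
apply: (conv_to_squeeze cNy cy) => n; last exact: le_trans (le_vabs _) (xay n).
by rewrite -[X in _ <= X]opprK vlerN2; exact: le_trans (leN_vabs _) (xay n).
Qed.

End convergence_theory.

(** * Finitely additive measures and sets of finite mass *)

Section finitely_additive_measure.
Set Implicit Arguments.
Unset Strict Implicit.
Context {R : realType} {V : dcVectorLatticeType R}
  {d : measure_display} {G : algebraOfSetsType d} (mu : fa_measure V G).
Implicit Types (A B E : set G).

(** Measurability is bundled in because [mu] is constrained on measurable sets only. *)
Definition finite_mass A := measurable A /\ xfinite (mu A).
Local Notation fin := finite_mass.
Local Notation mass A := (xval (mu A)).

Lemma mass_ge0 A : measurable A -> 0 <= mass A.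
Proof. by move=> /(fa_mu_ge0 mu); case: (mu A). Qed.

Lemma mass0 : mass set0 = 0. Proof. by rewrite fa_mu0. Qed.

Lemma fin0 : fin set0.
Proof. by split => //; rewrite fa_mu0; exists 0. Qed.

(** Stated in the extended cone, so that it applies before the pieces are known to be finite;
    [massID] is its counterpart in [V]. *)
Lemma fa_muID A E : measurable A -> measurable E ->
  mu A = xadd (mu (A `&` E)) (mu (A `\` E)).
Proof.
move=> mA mE; rewrite -fa_muU; first by rewrite setUIDK.
- exact: measurableI.
- exact: measurableD.
- by rewrite setIDA; apply/seteqP; split => g // [[[? ?] ?] ?].
Qed.

(** A sum in the extended cone is finite only if both terms are. *)
Lemma sub_fin A B : measurable A -> A `<=` B -> fin B -> fin A.
Proof.
move=> mA AB [mB [b muB]]; split => //; have := fa_muID mB mA.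
rewrite (setIidr AB) muB; by case: (mu A) => [a _|//]; exists a.
Qed.

Lemma finI A B : fin A -> measurable B -> fin (A `&` B).
Proof.
by move=> fA mB; apply: (sub_fin _ _ fA) => //; apply: measurableI; case: fA.
Qed.

Lemma finD A B : fin A -> measurable B -> fin (A `\` B).
Proof.
by move=> fA mB; apply: (sub_fin _ _ fA) => //; apply: measurableD; case: fA.
Qed.

Lemma finU A B : fin A -> fin B -> fin (A `|` B).
Proof.
move=> fA fB; have [mA [a muA]] := fA; have [_ [b muB]] := finD fB mA.
split; first by apply: measurableU; [|case: fB].
exists (a + b); have := @fa_muU _ _ _ _ mu A (B `\` A) mA.
rewrite setDE setUIr setUv setIT -setDE muA muB; apply.
  by apply: measurableD; [case: fB|].
by apply/seteqP; split => g // [? []].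
Qed.

Lemma massID A E : fin A -> measurable E ->
  mass A = mass (A `&` E) + mass (A `\` E).
Proof.
move=> fA mE; rewrite (fa_muID fA.1 mE).
by have [_ [? ->]] := finI fA mE; have [_ [? ->]] := finD fA mE.
Qed.

Lemma le_mass A B : measurable A -> A `<=` B -> fin B -> mass A <= mass B.
Proof.
move=> mA AB fB; rewrite (massID fB mA) (setIidr AB) -vsubr_ge0.
by rewrite addrAC subrr add0r mass_ge0//; apply: measurableD; case: fB.
Qed.

End finitely_additive_measure.

(** * Simple functions as lists of weighted sets *)

Section simple_functions.
Set Implicit Arguments.
Unset Strict Implicit.
Context {R : realType} {X1 X2 : dcVectorLatticeType R}
  {d : measure_display} {G : algebraOfSetsType d} (mu : fa_measure X2 G).
Implicit Types (v : X1) (A E : set G) (f : G -> X1) (s t : seq (X1 * set G)).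
Local Notation fin := (finite_mass mu).

(** Lists replace families over ['I_r] to allow structural induction and concatenation; the sets may
    overlap. *)
Definition step s : G -> X1 := fun g => \sum_(e <- s) \1_(e.2) g *: e.1.

Fixpoint step_fin s : Prop :=
  if s is e :: s' then fin e.2 /\ step_fin s' else True.

(** May exceed the true support, since overlapping terms can cancel; what matters is that [step s]
    vanishes outside it. *)
Fixpoint step_support s : set G :=
  if s is e :: s' then e.2 `|` step_support s' else set0.

Definition step_opp s := [seq (- e.1, e.2) | e <- s].

Lemma step_cons e s g : step (e :: s) g = \1_(e.2) g *: e.1 + step s g.
Proof. exact: big_cons. Qed.

Lemma step_cat s t g : step (s ++ t) g = step s g + step t g.
Proof. exact: big_cat. Qed.

Lemma step_fin_cat s t :
  step_fin s -> step_fin t -> step_fin (s ++ t).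
Proof. by elim: s => //= e s IH [fe fs] ft; split; [|exact: IH]. Qed.

Lemma step_oppE s g : step (step_opp s) g = - step s g.
Proof.
rewrite /step big_map -sumrN; apply: eq_bigr => e _.
by rewrite scalerN.
Qed.

Lemma step_fin_opp s : step_fin s -> step_fin (step_opp s).
Proof. by elim: s => //= e s IH [fe fs]; split; [|exact: IH]. Qed.

Lemma fin_step_support s : step_fin s -> fin (step_support s).
Proof.
by elim: s => [_|e s IH [fe fs]]; [exact: fin0|apply: finU => //; exact: IH].
Qed.

Lemma step_notin s g : ~ step_support s g -> step s g = 0.
Proof.
elim: s => [_|e s IH /= /not_orP[eg sg]]; first exact: big_nil.
by rewrite step_cons indicE memNset// scale0r add0r IH.
Qed.

(** Avoids disjoint representations: for a head [(a, E)], the induction splits [A] along [E],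
    replacing [v] by [v + a] on [E] and keeping [v] off it. The cut-off to [A] is needed because
    [phi 0] may be nonzero. *)
Lemma step_comp (phi : X1 -> X1) s A v : step_fin s -> fin A ->
  exists2 t, step_fin t & step t = fun g => \1_A g *: phi (v + step s g).
Proof.
elim: s A v => [|[a E] s IH] A v /= => [_ fA|[fE fs] fA].
  exists [:: (phi v, A)] => //; apply/funext => g.
  by rewrite step_cons /step !big_nil !addr0.
have [t1 ft1 t1E] := IH _ (v + a) fs (finI fA fE.1).
have [t2 ft2 t2E] := IH _ v fs (finD fA fE.1).
exists (t1 ++ t2); first exact: step_fin_cat.
apply/funext => g.
rewrite step_cat t1E t2E step_cons !indicE in_setI in_setD /=.
have [gE|gE] := boolP (g \in E).
  by rewrite andbT andbF scale0r addr0 scale1r addrA.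
by rewrite andbT andbF scale0r scale0r !add0r.
Qed.

Lemma simple_repr_step f r (a : 'I_r -> X1) (A_ : 'I_r -> set G) :
  let s := [seq (a j, A_ j) | j <- enum 'I_r] in
  simple_repr mu f a A_ -> step_fin s /\ f = step s.
Proof.
move=> s [fA ->]; split.
  by rewrite /s; elim: (enum _) => //= j js IH; split; [exact: fA|].
by apply/funext => g; rewrite /step big_map big_enum.
Qed.

Lemma simple_funP f :
  simple_fun mu f <-> exists2 s, step_fin s & f = step s.
Proof.
split=> [[r [a [A_ /simple_repr_step[fs sE]]]]|[s fs ->]].
  by exists [seq (a j, A_ j) | j <- enum 'I_r].
exists (size s), (fun j => (tnth (in_tuple s) j).1),
  (fun j => (tnth (in_tuple s) j).2); split.
  move=> j; rewrite (tnth_nth (0, set0)) /=.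
  elim: s fs j => [_ [] //|e s IH [fe fs] [[|j] /= js]] //.
  exact: IH fs (Ordinal (js : (j < size s)%N)).
by apply/funext => g; rewrite /step big_tnth.
Qed.

Local Notation simple := (simple_fun mu).

(** The cut-off of [step_comp] at the support is harmless, as [vabs 0 = 0]. *)
Lemma simple_vabs f : simple f -> simple (vabs \o f).
Proof.
move=> /simple_funP[s fs ->]; apply/simple_funP.
have [t ft tE] := step_comp vabs 0 fs (fin_step_support fs).
exists t => //; rewrite tE; apply/funext => g /=; rewrite indicE add0r.
have [/mem_set ->|gs] := pselect (step_support s g); first by rewrite scale1r.
by rewrite memNset// scale0r step_notin// vabs0.
Qed.

Lemma simpleN f : simple f -> simple (fun g => - f g).
Proof.
move=> /simple_funP[s fs ->]; apply/simple_funP; exists (step_opp s).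
  exact: step_fin_opp.
by apply/funext => g; rewrite step_oppE.
Qed.

Lemma simple_indic A v : fin A -> simple (fun g => \1_A g *: v).
Proof.
move=> fA; apply/simple_funP; exists [:: (v, A)] => //.
by apply/funext => g; rewrite /step big_seq1.
Qed.

End simple_functions.

(** * Integrals of simple functions *)

Section simple_integral.
Set Implicit Arguments.
Unset Strict Implicit.
Context {R : realType} {X1 X2 X : dcVectorLatticeType R}
  {c1 : convergence X1} {c2 : convergence X2} {c : convergence X}
  (p : product_triple c1 c2 c)
  {d : measure_display} {G : algebraOfSetsType d} (mu : fa_measure X2 G).
Implicit Types (x v : X1) (y : X2) (A B E : set G) (f h : G -> X1)
  (s t : seq (X1 * set G)).
Local Notation SI := (simple_integral p mu).
Local Notation simple := (simple_fun mu).
Local Notation fin := (finite_mass mu).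
Local Notation mass A := (xval (mu A)).

Lemma triple_mul0r x : p x 0 = 0.
Proof. by apply: (addIr (p x 0)); rewrite -triple_mulDr !add0r. Qed.

Lemma triple_mul0l y : p 0 y = 0.
Proof. by apply: (addIr (p 0 y)); rewrite -triple_mulDl !add0r. Qed.

Lemma triple_mulNl x y : p (- x) y = - p x y.
Proof.
by apply: (addIr (p x y)); rewrite -triple_mulDl !addNr triple_mul0l.
Qed.

Lemma triple_mul_ge0 x y : 0 <= x -> 0 <= y -> 0 <= p x y.
Proof. by move=> x0 y0; rewrite -(triple_mul0l y); exact: triple_le_mull. Qed.

Definition step_integral s A : X :=
  \sum_(e <- s) p e.1 (mass (A `&` e.2)).

Lemma step_integral_cat s t A :
  step_integral (s ++ t) A = step_integral s A + step_integral t A.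
Proof. exact: big_cat. Qed.

Lemma step_integral_opp s A :
  step_integral (step_opp s) A = - step_integral s A.
Proof.
rewrite /step_integral big_map -sumrN; apply: eq_bigr => e _.
exact: triple_mulNl.
Qed.

(** With [S] the support, this reduces integrals over arbitrary sets to sets of finite mass. *)
Lemma step_integral_setI s A S : step_support s `<=` S ->
  step_integral s A = step_integral s (A `&` S).
Proof.
rewrite /step_integral; elim: s => [|e s IH] /=; first by rewrite !big_nil.
rewrite subUset => -[eS sS]; rewrite !big_cons IH//; congr (p _ (mass _) + _).
by rewrite -setIA (setIidr eS).
Qed.

Lemma step_integralID s A E :
  step_fin mu s -> measurable A -> measurable E ->
  step_integral s A = step_integral s (A `&` E) + step_integral s (A `\` E).
Proof.
rewrite /step_integral => fs mA mE.
elim: s fs => [|e s IH /= [fe fs]]; first by rewrite !big_nil addr0.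
rewrite !big_cons (IH fs) addrACA -triple_mulDr; congr (p _ _ + _).
have fAe : fin (A `&` e.2) by rewrite setIC; exact: finI.
rewrite (massID fAe mE); congr (mass _ + mass _).
  by rewrite setIAC.
by rewrite !setDE setIAC.
Qed.

(* The constant [v] makes the induction go through: the head [(a, E)] of the
   list is absorbed into it as [v + a] on [A `&` E] and as [v] on [A `\` E]. *)
Lemma step_integral_shift_ge0 s A v : step_fin mu s -> fin A ->
  (forall g, A g -> 0 <= v + step s g) ->
  0 <= p v (mass A) + step_integral s A.
Proof.
elim: s A v => [|[a E] s IH] A v fs fA.
  rewrite /step_integral big_nil addr0 => vA.
  (* The sign of [v] is known only if [A] has a point; otherwise the mass is 0. *)
  have [->|/set0P[g /vA]] := eqVneq A set0.
    by rewrite mass0 triple_mul0r.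
  rewrite /step big_nil addr0 => v0.
  by apply: triple_mul_ge0 => //; apply: mass_ge0; case: fA.
have [fE {}fs] := fs => A_ge0; have [mE _] := fE.
rewrite /step_integral big_cons -/(step_integral s A) /=.
rewrite (step_integralID fs fA.1 mE) (massID fA mE) triple_mulDr.
have EI : 0 <= p (v + a) (mass (A `&` E)) + step_integral s (A `&` E).
  apply: IH => // [|g [Ag Eg]]; first exact: finI.
  by have := A_ge0 g Ag; rewrite step_cons indicE mem_set// scale1r addrA.
have ED : 0 <= p v (mass (A `\` E)) + step_integral s (A `\` E).
  apply: IH => // [|g [Ag Eg]]; first exact: finD.
  by have := A_ge0 g Ag; rewrite step_cons indicE memNset// scale0r add0r.
have := vadd_ge0 EI ED.
by rewrite triple_mulDl addrACA (addrAC (p v _)) -!addrA.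
Qed.

Lemma step_integral_ge0 s A : step_fin mu s -> measurable A ->
  (forall g, A g -> 0 <= step s g) -> 0 <= step_integral s A.
Proof.
move=> fs mA s0; rewrite (@step_integral_setI _ _ (step_support s))//.
have := @step_integral_shift_ge0 s (A `&` step_support s) 0 fs.
rewrite triple_mul0l add0r; apply.
  by rewrite setIC; apply: finI => //; exact: fin_step_support.
by move=> g [Ag _]; rewrite add0r; exact: s0.
Qed.

(** Positivity is applied to the concatenation of [t] with the opposite of [s], which represents the
    difference. *)
Lemma le_step_integral s t A : step_fin mu s -> step_fin mu t ->
  measurable A -> (forall g, A g -> step s g <= step t g) ->
  step_integral s A <= step_integral t A.
Proof.
move=> fs ft mA st; rewrite -vsubr_ge0.
rewrite -step_integral_opp -step_integral_cat.
apply: step_integral_ge0 => //.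
  by apply: step_fin_cat => //; exact: step_fin_opp.
by move=> g Ag; rewrite step_cat step_oppE vsubr_ge0; exact: st.
Qed.

(** Independence of the representation: two lists with the same step function have integrals
    bounding each other, by monotonicity. *)
Lemma simple_integralE s A : step_fin mu s -> measurable A ->
  simple_integral p mu (step s) A = step_integral s A.
Proof.
move=> fs mA; rewrite /simple_integral; case: xgetP.
  move=> v _ [r [a [A_ [/simple_repr_step[ft st] ->]]]].
  have -> : \sum_(j < r) p (a j) (mass (A `&` A_ j)) =
      step_integral [seq (a j, A_ j) | j <- enum 'I_r] A.
    by rewrite /step_integral big_map big_enum.
  by apply: le_anti; rewrite !le_step_integral// => g _; rewrite st.
(* The default value of [xget] is never taken, since a representation exists. *)
have [r [a [A_ rE]]] : simple_fun mu (step s) by apply/simple_funP; exists s.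
by move=> /(_ (\sum_(j < r) p (a j) (mass (A `&` A_ j))))[]; exists r, a, A_.
Qed.

Lemma simple_integralN f A : simple f -> measurable A ->
  SI (fun g => - f g) A = - SI f A.
Proof.
move=> /simple_funP[s fs ->] mA.
rewrite (_ : (fun _ => _) = step (step_opp s)); last first.
  by apply/funext => g; rewrite step_oppE.
by rewrite !simple_integralE ?step_integral_opp//; exact: step_fin_opp.
Qed.

Lemma simple_integral_indic A E v : fin A -> measurable E ->
  SI (fun g => \1_A g *: v) E = p v (mass (E `&` A)).
Proof.
move=> fA mE; rewrite (_ : (fun _ => _) = step [:: (v, A)]); last first.
  by apply/funext => g; rewrite /step big_seq1.
by rewrite simple_integralE// /step_integral big_seq1.
Qed.

Lemma le_simple_integral f h A : simple f -> simple h -> measurable A ->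
  (forall g, A g -> f g <= h g) -> SI f A <= SI h A.
Proof.
move=> /simple_funP[s fs ->] /simple_funP[t ft ->] mA st.
by rewrite !simple_integralE//; exact: le_step_integral.
Qed.

Lemma simple_integralID f A E : simple f -> measurable A -> measurable E ->
  SI f A = SI f (A `&` E) + SI f (A `\` E).
Proof.
move=> /simple_funP[s fs ->] mA mE; rewrite !simple_integralE//.
- exact: step_integralID.
- exact: measurableD.
- exact: measurableI.
Qed.

Lemma simple_integral_ge0 f A : simple f -> measurable A ->
  (forall g, A g -> 0 <= f g) -> 0 <= SI f A.
Proof.
move=> /simple_funP[s fs ->] mA s0; rewrite simple_integralE//.
exact: step_integral_ge0.
Qed.

Lemma vabs_simple_integral_le f A B : simple f -> measurable A ->
  measurable B -> A `<=` B -> vabs (SI f A) <= SI (vabs \o f) B.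
Proof.
move=> sf mA mB AB; have saf := simple_vabs sf.
apply: (@le_trans _ _ (SI (vabs \o f) A)).
  apply/vabs_le; split.
    by apply: le_simple_integral => // g _; exact: le_vabs.
  rewrite -simple_integralN//; apply: le_simple_integral => //.
    exact: simpleN.
  by move=> g _; exact: leN_vabs.
rewrite [leRHS](simple_integralID saf mB mA) (setIidr AB).
rewrite -[leLHS]addr0; apply: vle_add => //.
apply: simple_integral_ge0 => //; first exact: measurableD.
by move=> g _; exact: vabs_ge0.
Qed.

(** [E] plays the exceptional set of a convergence in measure: on it [f] is controlled only by
    [vabs \o f], and off it by the constant [v], whose integral grows when [A]\[E] is enlarged to
    [A]. *)
Lemma simple_integral_bound f A E v : simple f -> fin A -> measurable E ->
  0 <= v -> (forall g, (A `\` E) g -> f g <= v) ->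
  SI f A <= SI (vabs \o f) (A `&` E) + p v (mass A).
Proof.
move=> sf fA mE v0 fv; have mA := fA.1.
rewrite (simple_integralID sf mA mE); apply: vle_add.
  apply: le_simple_integral; [by []|exact: simple_vabs|exact: measurableI|].
  by move=> g _; exact: le_vabs.
have mAE : measurable (A `\` E) by exact: measurableD.
apply: (@le_trans _ _ (SI (fun g => \1_A g *: v) (A `\` E))).
  apply: le_simple_integral => //; first exact: simple_indic.
  by move=> g [Ag Eg]; rewrite indicE mem_set// scale1r; exact: fv.
rewrite simple_integral_indic//; apply: triple_le_mulr => //.
by apply: le_mass => //; exact: measurableI.
Qed.

End simple_integral.

(** * Passage to the limit from simple to integrable functions *)

Section lattice_integral.
Set Implicit Arguments.
Unset Strict Implicit.
Context {R : realType} {X1 X2 X : dcVectorLatticeType R}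
  {c1 : convergence X1} {c2 : convergence X2} {c : convergence X}
  (p : product_triple c1 c2 c)
  {d : measure_display} {G : algebraOfSetsType d} (mu : fa_measure X2 G).
Implicit Types (f : G -> X1) (A B E : set G) (l : set G -> X).
Local Notation SI := (simple_integral p mu).
Local Notation simple := (simple_fun mu).
Local Notation fin := (finite_mass mu).
Local Notation mass A := (xval (mu A)).

Lemma simple_integral_cvg (s : nat -> G -> X1) l A :
  sup_conv_to c (fun n => [set vabs (SI (s n) B - l B) | B in measurable]) 0 ->
  measurable A -> conv_to c (fun n => SI (s n) A) (l A).
Proof.
move=> [t ts ct] mA; apply: (conv_to_dist0 ct) => n.
by apply: (pos_sup_ub (ts n)); exists A.
Qed.

(** [t n] is the supremum of the distances off [E n], nonnegative even for an empty family, where it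
    is 0 by convention. *)
Lemma cvg_in_measure_bound (s : nat -> G -> X1) f A :
  cvg_in_measure c1 c2 mu s f A -> exists (E : nat -> set G) (t : nat -> X1),
  [/\ forall n, measurable (E n), xconv_to c2 (fun n => mu (A `&` E n)) 0,
      conv_to c1 t 0, forall n, 0 <= t n &
      forall n g, (A `\` E n) g -> vabs (s n g - f g) <= t n].
Proof.
move=> [E [mE cE [t tE ct]]]; exists E, t; split => // n.
  by apply: (pos_sup_ge0 _ (tE n)) => _ [g _ <-]; exact: vabs_ge0.
by move=> g AEg; apply: (pos_sup_ub (tE n)); exists g.
Qed.

Lemma spec_additive f l A E : lat_pos_integral_spec p mu f l ->
  measurable A -> measurable E -> l A = l (A `&` E) + l (A `\` E).
Proof.
move=> [s [ss _ _] /simple_integral_cvg sl] mA mE.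
apply: conv_to_unique (sl _ mA) _.
apply: conv_to_ext (conv_toD (sl _ (measurableI _ _ mA mE))
                             (sl _ (measurableD mA mE))) => n.
by rewrite -simple_integralID.
Qed.

Lemma spec_le f l A u : lat_pos_integral_spec p mu f l -> fin A -> 0 <= u ->
  (forall g, A g -> f g <= u) -> l A <= p u (mass A).
Proof.
move=> [s [ss scvg [sabs _]] /simple_integral_cvg sl] fA u0 fu.
have [mA xA] := fA.
have [E [t [mE cE ct t0 tE]]] := cvg_in_measure_bound (scvg _ mA xA).
have mAE n : measurable (A `&` E n) by exact: measurableI.
(* The integrals over [A]&[E n] vanish in the limit by equiabsolute continuity (i); off [E n] the
   approximant is at most [t n + u]. Only [p u (mass A)] survives. *)
have := conv_toD (sabs _ mAE cE) (conv_toD (triple_convl p (mass A) ct)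
  (conv_to_cst c (p u (mass A)))).
rewrite !add0r => ub; apply: (conv_to_le (sl _ mA) ub) => n.
rewrite -triple_mulDl; apply: simple_integral_bound => //.
  exact: vadd_ge0.
move=> g AEg; rewrite -(subrK (f g) (s n g)); apply: vle_add.
  exact: le_trans (le_vabs _) (tE n g AEg).
by apply: fu; case: AEg.
Qed.

(** The approximants need not be positive, but [- s n <= f - s n <= t n] off [E n]; so
    [simple_integral_bound] for [- s n] bounds [- l A] by a null sequence. *)
Lemma spec_fin_ge0 f l A : lat_pos_integral_spec p mu f l -> fin A ->
  (forall g, 0 <= f g) -> 0 <= l A.
Proof.
move=> [s [ss scvg [sabs _]] /simple_integral_cvg sl] fA f0; have [mA xA] := fA.
have [E [t [mE cE ct t0 tE]]] := cvg_in_measure_bound (scvg _ mA xA).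
have mAE n : measurable (A `&` E n) by exact: measurableI.
have := conv_toD (sabs _ mAE cE) (triple_convl p (mass A) ct).
rewrite -voppr_le0 addr0 => ub.
apply: (conv_to_le (conv_toN (sl _ mA)) ub) => n.
rewrite -simple_integralN//.
have -> : vabs \o s n = vabs \o (fun g => - s n g).
  by apply/funext => g /=; rewrite vabsN.
apply: simple_integral_bound => //; first exact: simpleN.
move=> g AEg; apply: le_trans (tE n g AEg); apply: le_trans (leN_vabs _).
by rewrite opprB -vler_subl opprK addNr.
Qed.

(* Equiabsolute continuity (ii) reduces an arbitrary measurable set to sets of
   finite measure. *)
Lemma spec_tail f l : lat_pos_integral_spec p mu f l ->
  exists (B : nat -> set G) (y : nat -> X),
    [/\ forall m, fin (B m), conv_to c y 0 &
        forall A m, measurable A -> vabs (l (A `\` B m)) <= y m].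
Proof.
move=> [s [ss _ [_ [B [fB _ [y By cy]]]]] /simple_integral_cvg sl].
exists B, y; split => // A m mA.
have mAB : measurable (A `\` B m) by apply: measurableD => //; case: (fB m).
have mB : measurable (~` B m) by apply: measurableC; case: (fB m).
have [labs_dom labs_lim] := conv_to_vabs (sl _ mAB).
have labs_ge0 n : 0 <= vabs (SI (s n) (A `\` B m)) by exact: vabs_ge0.
have := conv_limsupE labs_ge0 labs_dom; rewrite labs_lim => limsupE.
suff : xle (XFin (vabs (l (A `\` B m)))) (XFin (y m)) by [].
rewrite -limsupE -By; apply: conv_limsup_le => // [n|].
  apply: simple_integral_ge0 => //; first exact: simple_vabs.
  by move=> g _; exact: vabs_ge0.
by exists 0%N => // n _; apply: vabs_simple_integral_le.
Qed.

(** The part of [A] in [B m] contributes at least 0 and the rest at least [- y m], which tends to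
    0. *)
Lemma spec_ge0 f l A : lat_pos_integral_spec p mu f l ->
  (forall g, 0 <= f g) -> measurable A -> 0 <= l A.
Proof.
move=> fl f0 mA; have [B [y [fB cy ly]]] := spec_tail fl.
have := conv_toN cy; rewrite oppr0 => cNy.
apply: (conv_to_le cNy (conv_to_cst c (l A))) => m.
rewrite (spec_additive fl mA (fB m).1) -[leLHS]add0r; apply: vle_add.
  by apply: spec_fin_ge0 fl _ f0; rewrite setIC; exact: finI.
rewrite -[leRHS]opprK vlerN2; apply: le_trans (leN_vabs _) _; exact: ly.
Qed.

Lemma spec0 l A : lat_pos_integral_spec p mu (fun=> 0) l -> measurable A ->
  l A = 0.
Proof.
move=> l0 mA; apply: le_anti; rewrite (spec_ge0 l0)// andbT.
have [B [y [fB cy ly]]] := spec_tail l0.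
apply: (conv_to_le (conv_to_cst c (l A)) cy) => m.
rewrite (spec_additive l0 mA (fB m).1) -[leRHS]add0r; apply: vle_add.
  rewrite -(triple_mul0l p (mass (A `&` B m))); apply: spec_le l0 _ _ _ => //.
  by rewrite setIC; exact: finI.
apply: le_trans (le_vabs _) _; exact: ly.
Qed.

(* If [f] is not integrable then [xget] returns the zero set function, which
   has the three properties as well. *)
Lemma lat_pos_integralP f : (forall g, 0 <= f g) ->
  let I := lat_pos_integral p mu f in
  [/\ forall A, measurable A -> 0 <= I A,
      forall A E, measurable A -> measurable E ->
        I A = I (A `&` E) + I (A `\` E) &
      forall A u, fin A -> 0 <= u -> (forall g, A g -> f g <= u) ->
        I A <= p u (mass A)].
Proof.
move=> f0 I; rewrite /I /lat_pos_integral.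
case: xgetP => [l _ fl|_]; split.
- by move=> A mA; exact: spec_ge0 fl f0 mA.
- by move=> A E mA mE; exact: spec_additive fl mA mE.
- by move=> A u fA u0 fu; exact: spec_le fl fA u0 fu.
- by [].
- by move=> A E _ _; rewrite addr0.
- by move=> A u [mA _] u0 _; apply: triple_mul_ge0 => //; exact: mass_ge0.
Qed.

(** The negative part is the zero function; any set function chosen for it vanishes on measurable
    sets by [spec0], and so does the default. *)
Lemma lat_integral_ge0E f A : (forall g, 0 <= f g) -> measurable A ->
  lat_integral p mu f A = lat_pos_integral p mu f A.
Proof.
move=> f0 mA; rewrite /lat_integral.
have -> : vpos \o f = f by apply/funext => g; exact: vpos_ge0.
have -> : vneg \o f = fun=> 0 by apply/funext => g; exact: vneg_ge0.
rewrite [X in _ - X](_ : _ = 0) ?subr0// {1}/lat_pos_integral.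
by case: xgetP => // l _ l0; exact: spec0 l0 mA.
Qed.

End lattice_integral.

(** * Convergence to 0 in mean *)

Theorem theorem3p13 (R : realType) (X1 X2 X : dcVectorLatticeType R)
  (cR : convergence R^o)
  (c1 : convergence X1) (c2 : convergence X2) (c : convergence X)
  (p : product_triple c1 c2 c)
  (pX1 : product_algebra c1) (pX2 : product_algebra c2)
  (pX : product_algebra c)
  (pRX : product_triple cR c c)
  (pRX1 : product_triple cR c1 c1) (pRX2 : product_triple cR c2 c2)
  (d : measure_display) (G : algebraOfSetsType d)
  (mu : fa_measure X2 G) (mu_sigma_finite : fa_sigma_finite mu)
  (f_ : nat -> G -> X1)
  (f_integrable : forall n, lat_integrable p mu (f_ n))
  (f_cvg : forall A : set G, measurable A -> xfinite (mu A) ->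
    cvg_in_measure c1 c2 mu f_ (fun=> 0) A)
  (f_equiabs : equiabs_continuous c2 c mu (lat_integral p mu) f_) :
  conv_to c (fun n => lat_integral p mu (vabs \o f_ n) [set: G]) 0.
Proof.
pose I n := lat_pos_integral p mu (vabs \o f_ n).
have f0 n g : 0 <= (vabs \o f_ n) g by exact: vabs_ge0.
have IE n A : measurable A -> lat_integral p mu (vabs \o f_ n) A = I n A.
  by move=> mA; exact: lat_integral_ge0E.
have I_ge0 n A : measurable A -> 0 <= I n A.
  by have [+ _ _] := lat_pos_integralP p mu (f0 n); exact.
have [f_abs [B [fB _ [y By cy]]]] := f_equiabs.
have mB m : measurable (~` B m) by apply: measurableC; case: (fB m).
apply: (@conv_to_ext _ _ _ (fun n => I n [set: G])) => [n|].
  by rewrite IE.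
suff limsup_le m : xle (conv_limsup c (fun n => I n [set: G])) (XFin (y m)).
  have IG_ge0 n : 0 <= I n [set: G] by exact: I_ge0.
  apply: conv_limsup_eq0 => //; have := conv_limsup_ge0 c IG_ge0.
  (* The bound at index 0 already excludes an infinite limit superior; a finite [L] is below every
     [y m], hence below their limit 0. *)
  case: (conv_limsup c _) limsup_le => [L|/(_ 0%N)//] Ly /= L0.
  congr XFin; apply: le_anti; rewrite L0 andbT.
  exact: (conv_to_le (conv_to_cst c L) cy).
have [E [t [mE cE ct t0 tE]]] :=
  cvg_in_measure_bound (f_cvg (B m) (fB m).1 (fB m).2).
have mBE n : measurable (B m `&` E n).
  by apply: measurableI => //; case: (fB m).
have mBD n : measurable (B m `\` E n).
  by apply: measurableD => //; case: (fB m).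
pose h n := I n (B m `&` E n) + I n (B m `\` E n).
have h_ge0 n : 0 <= h n by apply: vadd_ge0; exact: I_ge0.
have [h_dom h_lim] : conv_to c h 0.
  rewrite -[0]addr0; apply: conv_toD.
    by apply: conv_to_ext (f_abs _ mBE cE) => n; rewrite IE.
  apply: (conv_to_squeeze (conv_to_cst c 0)
    (triple_convl p (xval (mu (B m))) ct)) => n; first exact: I_ge0.
  have [_ _ I_le] := lat_pos_integralP p mu (f0 n).
  (* Enlarging [B m]\[E n] to [B m] makes the second factor independent of [n], so that the product
     with [t n] tends to 0. *)
  apply: le_trans (triple_le_mulr p (t0 n) _).
    apply: I_le => [| |g BEg]; [exact: finD|exact: t0|].
    by have := tE n g BEg; rewrite subr0.
  exact: le_mass.
have tail_ge0 n : 0 <= I n (~` B m) by exact: I_ge0.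
have -> : (fun n => I n [set: G]) = (fun n => I n (~` B m) + h n).
  apply/funext => n; have [_ ID _] := lat_pos_integralP p mu (f0 n).
  rewrite /I (ID _ (B m) measurableT (fB m).1) setTI setTD addrC; congr (_ + _).
  exact: ID (fB m).1 (mE n).
(* By subadditivity, only the tail contributes: [h] converges, so its limit superior is its limit
   0. *)
have := conv_limsupD c tail_ge0 h_ge0.
rewrite (conv_limsupE h_ge0 h_dom) h_lim.
have -> : conv_limsup c (fun n => I n (~` B m)) = XFin (y m).
  by rewrite -By; congr conv_limsup; apply/funext => n; rewrite IE.
by rewrite /= addr0.
Qed.
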